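(* Let $G_1$ and $G_2$ be two commutative multiplicative hyperrings with identities $1_{G_1}$ and $1_{G_2}$, let $\eta:G_1\to G_2$ be a hyperring good homomorphism, let $A_1$ and $A_2$ be $\mathcal{C}$-hyperideals of $G_1$ and $G_2$, respectively, and let $S$ be a multiplicative closed subset of $G_1$ such that $0_{G_2}\notin\eta(S)$. Then: (i) If $A_2$ is a quasi $\eta(S)$-primary hyperideal of $G_2$, then $\eta^{-1}(A_2)$ is a quasi $S$-primary hyperideal of $G_1$. (ii) If $A_1$ is a quasi $S$-primary hyperideal of $G_1$ with $\mathrm{Ker}(\eta)\subseteq A_1$ and $\eta$ is surjective, then $\eta(A_1)$ is a quasi $\eta(S)$-primary hyperideal of $G_2$.
   Context: A commutative multiplicative hyperring with identity is a triple $(G,+,\circ)$ where $(G,+)$ is an abelian group and $\circ$ assigns to each pair $(x,y)\in G\times G$ a non-empty subset $x\circ y\subseteq G$, such that for all $x,y,z\in G$: $(x\circ y)\circ z=x\circ(y\circ z)$; $(-x)\circ y=x\circ(-y)=-(x\circ y)$; $(y+z)\circ x\subseteq y\circ x+z\circ x$ and $x\circ(y+z)\subseteq x\circ y+x\circ z$; $x\circ y=y\circ x$; and there is $1\in G$ with $a\in 1\circ a$ for all $a\in G$. For non-empty subsets $X,Y\subseteq G$, $X\circ Y=\bigcup_{x\in X,y\in Y}x\circ y$ and $X+Y=\{x+y: x\in X,y\in Y\}$; elements are identified with singletons. A hyperideal of $G$ is a non-empty $A\subseteq G$ with $x-y\in A$ for all $x,y\in A$ and $r\circ x\subseteq A$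 for all $x\in A$, $r\in G$. A proper hyperideal $P$ is prime if $x\circ y\subseteq P$ ($x,y\in G$) implies $x\in P$ or $y\in P$. $\mathrm{rad}(A)$ is the intersection of all prime hyperideals containing $A$, and $\mathrm{rad}(A)=G$ if there are none. $A$ is a $\mathcal{C}$-hyperideal if for all $n\in\mathbb{N}$ and $a_1,\dots,a_n\in G$, $(a_1\circ\cdots\circ a_n)\cap A\neq\varnothing$ implies $a_1\circ\cdots\circ a_n\subseteq A$. A multiplicative closed subset (MCS) of $G$ is a subset $S\subseteq G$ containing $1$ with $(s_1\circ s_2)\cap S\neq\varnothing$ for all $s_1,s_2\in S$. A hyperideal $A$ with $A\cap S=\varnothing$ is quasi $S$-primary if there is $t\in S$ such that for all $u,v\in G$, $u\circ v\subseteq A$ implies $t\circ u\subseteq \mathrm{rad}(A)$ or $t\circ v\subseteq\mathrm{rad}(A)$. A map $\eta:(G_1,+_1,\circ_1)\to(G_2,+_2,\circ_2)$ is a hyperring good homomorphism if $\eta(a+_1b)=\eta(a)+_2\eta(b)$ and $\eta(a\circ_1 b)=\eta(a)\circ_2\eta(b)$ for all $a,b\in G_1$, and $\eta(1_{G_1})=1_{G_2}$. $\mathrm{Ker}(\eta)=\{x\in G_1:\eta(x)=0_{G_2}\}$. *)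

(* Defs.v *)
From HB Require Import structures.
From mathcomp Require Import all_boot all_algebra.
From mathcomp Require Import boolp classical_sets functions.

Set Implicit Arguments.
Unset Strict Implicit.
Unset Printing Implicit Defensive.

Import GRing.Theory.
Local Open Scope classical_set_scope.
Local Open Scope ring_scope.

Definition set_add (G : zmodType) (X Y : set G) : set G :=
  [set x + y | x in X & y in Y].

Definition set_opp (G : zmodType) (X : set G) : set G := [set - x | x in X].

Definition lift_hmul (G : Type) (m : G -> G -> set G) (X Y : set G) : set G :=
  \bigcup_(x in X) \bigcup_(y in Y) m x y.

(* The identity [hone] is part of the data; it need not be unique. *)
HB.mixin Record Zmodule_isComMulHyperring G of GRing.Zmodule G := {
  hone : G;
  hmul : G -> G -> set G;
  hmul_neq0 : forall x y, hmul x y !=set0;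
  hmulA : forall x y z,
    lift_hmul hmul (hmul x y) [set z] = lift_hmul hmul [set x] (hmul y z);
  hmulC : forall x y, hmul x y = hmul y x;
  hmulNl : forall x y, hmul (- x) y = set_opp (hmul x y);
  hmulNr : forall x y, hmul x (- y) = set_opp (hmul x y);
  hmulDl : forall x y z, hmul (y + z) x `<=` set_add (hmul y x) (hmul z x);
  hmulDr : forall x y z, hmul x (y + z) `<=` set_add (hmul x y) (hmul x z);
  hmul1 : forall a, hmul hone a a
}.

#[short(type="comMulHyperringType")]
HB.structure Definition ComMulHyperring :=
  { G of Zmodule_isComMulHyperring G & GRing.Zmodule G }.

Section Hyperideals.
Variable G : comMulHyperringType.
Implicit Types (A P S X Y : set G).

Definition set_hmul X Y : set G := lift_hmul (@hmul G) X Y.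

(* a o s_1 o ... o s_k: lists are split as head and tail so that only
   non-empty products occur. *)
Definition hprod (a : G) (s : seq G) : set G :=
  foldl (fun X y => set_hmul X [set y]) [set a] s.

Definition hyperideal A : Prop :=
  [/\ A !=set0,
      (forall x y, A x -> A y -> A (x - y)) &
      (forall r x, A x -> hmul r x `<=` A)].

Definition prime_hyperideal P : Prop :=
  [/\ hyperideal P, P <> setT &
      (forall x y, hmul x y `<=` P -> P x \/ P y)].

(* When no prime hyperideal contains A, this intersection is setT. *)
Definition rad A : set G :=
  \bigcap_(P in [set P | prime_hyperideal P /\ A `<=` P]) P.

Definition C_hyperideal A : Prop :=
  hyperideal A /\
  (forall a s, hprod a s `&` A !=set0 -> hprod a s `<=` A).

Definition mult_closed S : Prop :=
  S (hone : G) /\ (forall s1 s2, S s1 -> S s2 -> hmul s1 s2 `&` S !=set0).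

Definition quasi_primary S A : Prop :=
  [/\ mult_closed S, hyperideal A, A `&` S = set0 &
      exists2 t, S t & forall u v, hmul u v `<=` A ->
        hmul t u `<=` rad A \/ hmul t v `<=` rad A].

End Hyperideals.

Section GoodHomomorphisms.
Variables G1 G2 : comMulHyperringType.

Definition good_hom (eta : G1 -> G2) : Prop :=
  [/\ (forall a b, eta (a + b) = eta a + eta b),
      (forall a b, eta @` hmul a b = hmul (eta a) (eta b)) &
      eta hone = hone].

Definition hker (eta : G1 -> G2) : set G1 := [set x | eta x = 0].

(* Makes the first clause of [quasi_primary (eta @` S)] automatic. *)
Lemma mult_closed_image (eta : G1 -> G2) (S : set G1) :
  good_hom eta -> mult_closed S -> mult_closed (eta @` S).
Proof.
move=> [_ etaM eta1] [S1 SM]; split; first by exists hone.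
move=> _ _ [s1 Ss1 <-] [s2 Ss2 <-]; have [z [zM Sz]] := SM _ _ Ss1 Ss2.
by exists (eta z); rewrite -etaM; split; exists z.
Qed.

End GoodHomomorphisms.

(* Main.v *)
Require Import Defs.
From mathcomp Require Import all_boot all_algebra.
From mathcomp Require Import boolp classical_sets functions.

(** Preimages of hyperideals under a good homomorphism [eta] are hyperideals,
preimages of primes are primes, and a product lies in [eta @^-1` A] exactly
when its image lies in [A]. So in both parts the witness [t] is transported
along [eta], and the only thing left to compare is radicals.

For the image (ii), if a prime [Q] contains [eta @` A1], then its preimage is
a prime containing [A1]; hence [eta] maps [rad A1] into [rad (eta @` A1)].
That [hker eta `<=` A1] makes [A1] the full preimage of [eta @` A1], which
transports the hypothesis on products and the disjointness from [S].

For the preimage (i), one needs [eta x \in rad A2] to imply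
[x \in rad (eta @^-1` A2)]. Primes of the source containing [eta @^-1` A2] need
not come from the target, so radicals are compared through powers: for a
C-hyperideal [A], every element of [rad A] has a power included in [A]
([rad_hpower_sub]), powers are transported by [eta], and an element one of
whose powers is included in [A] lies in [rad A] ([hpower_sub_rad]).

The first of these facts is Krull's separation argument
([prime_hyperideal_avoiding]): a hyperideal that is maximal among those
disjoint from a given multiplicatively closed set is prime. If no power of [x]
is included in [A], the C-property makes all of them disjoint from [A], so
that a prime containing [A] avoids all powers of [x], in particular [x]. *)

Set Implicit Arguments.
Unset Strict Implicit.
Unset Printing Implicit Defensive.

Import GRing.Theory.
Local Open Scope classical_set_scope.
Local Open Scope ring_scope.

(** * Colon hyperideals and prime avoidance *)

Section HyperidealTheory.
Variable G : comMulHyperringType.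
Implicit Types (A P T : set G) (x y z : G).

Lemma hyperideal0 A : hyperideal A -> A 0.
Proof. by move=> [[a Aa] AB _]; rewrite -(subrr a); apply: AB. Qed.

Lemma hyperidealD A x y : hyperideal A -> A x -> A y -> A (x + y).
Proof.
move=> Ah Ax Ay; have [_ AB _] := Ah.
rewrite -[y]opprK; apply: (AB _ _ Ax); rewrite -sub0r; apply: AB => //.
exact: hyperideal0.
Qed.

Lemma hyperideal1 A : hyperideal A -> A hone -> A = setT.
Proof.
move=> [_ _ AM] A1; apply/seteqP; split=> // a _.
by apply: (AM a _ A1); rewrite hmulC; apply: hmul1.
Qed.

Lemma in_hmulA x y z w c :
  hmul y z c -> hmul x c w -> exists2 d, hmul x y d & hmul d z w.
Proof.
move=> yzc xcw.
have : lift_hmul (@hmul G) [set x] (hmul y z) w by exists x => //; exists c.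
by rewrite -hmulA => -[d xyd [_ -> dzw]]; exists d.
Qed.

(** The colon hyperideal [(P : b)]. *)
Definition hcolon P b : set G := [set y | hmul y b `<=` P].

Lemma hcolon_sup P b : hyperideal P -> P `<=` hcolon P b.
Proof. by move=> [_ _ PM] y Py; rewrite /hcolon /= hmulC; apply: PM. Qed.

Lemma hcolon_hyperideal P b : hyperideal P -> hyperideal (hcolon P b).
Proof.
move=> Ph; have [_ PB PM] := Ph; split.
- by exists 0; apply: hcolon_sup => //; apply: hyperideal0.
- move=> x y Qx Qy _ /hmulDl[u xbu [v + <-]].
  rewrite hmulNl => -[w ybw <-]; apply: PB; [exact: Qx|exact: Qy].
- move=> r x Qx c; rewrite hmulC => xrc w; rewrite hmulC => bcw.
  have [d bxd drw] := in_hmulA xrc bcw.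
  by apply: (PM r d); [apply: Qx; rewrite hmulC|rewrite hmulC].
Qed.

(** The maximal element is prime because of colon hyperideals: if
[hmul a b `<=` P] with [a] and [b] outside [P], then [(P : b)] contains [a],
so by maximality it contains some [z] in [T]; then [(P : z)] contains [b], so
it contains some [w] in [T], and [hmul w z] is included in [P] although it
meets [T]. *)
Lemma maximal_avoiding_prime P T :
    hyperideal P -> P `&` T = set0 -> T !=set0 ->
    (forall z w, T z -> T w -> hmul z w `&` T !=set0) ->
    (forall Q, hyperideal Q -> P `<` Q -> Q `&` T !=set0) ->
  prime_hyperideal P.
Proof.
move=> Ph PT [t Tt] TM Pmax.
have PnT z : P z -> ~ T z by move=> Pz Tz; rewrite -[False]/(set0 z) -PT.
have colonT a b : hmul a b `<=` P -> ~ P a -> exists2 z, T z & hmul z b `<=` P.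
  move=> abP nPa.
  have [|z [zb Tz]] := Pmax _ (hcolon_hyperideal b Ph); last by exists z.
  by split; [exact: hcolon_sup|move=> /(_ a abP)].
split=> // [PT1|a b abP]; first by apply: (PnT t) => //; rewrite PT1.
apply: contrapT => /not_orP[nPa nPb].
have [z Tz] := colonT _ _ abP nPa; rewrite hmulC => bzP.
have [w Tw wzP] := colonT _ _ bzP nPb.
by have [c [/wzP Pc Tc]] := TM _ _ Tw Tz; apply: PnT Tc.
Qed.

Lemma chain_union_hyperideal A (F : set (set G)) :
    hyperideal A -> total_on F subset ->
    (forall X, F X -> hyperideal (A `|` X)) ->
  hyperideal (A `|` \bigcup_(X in F) X).
Proof.
move=> Ah Ftot Fh; have [-> |/set0P[X0 FX0]] := eqVneq F set0.
  by rewrite bigcup_set0 setU0.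
have inF x : (A `|` \bigcup_(X in F) X) x -> exists2 X, F X & (A `|` X) x.
  move=> [Ax|[X FX Xx]]; first by exists X0 => //; left.
  by exists X => //; right.
have Fin X x : F X -> (A `|` X) x -> (A `|` \bigcup_(X in F) X) x.
  by move=> FX [Ax|Xx]; [left|right; exists X].
split.
- by exists 0; left; apply: hyperideal0.
- move=> x y /inF[X FX Xx] /inF[Y FY Yy].
  have [XY|YX] := Ftot _ _ FX FY.
  + have [_ YB _] := Fh _ FY.
    by apply: (Fin Y) => //; apply: YB => //; apply: setUS Xx.
  + have [_ XB _] := Fh _ FX.
    by apply: (Fin X) => //; apply: XB => //; apply: setUS Yy.
- move=> r x /inF[X FX Xx] c rxc; apply: (Fin X) => //.
  by have [_ _ XM] := Fh _ FX; apply: XM rxc.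
Qed.

Lemma prime_hyperideal_avoiding A T :
    hyperideal A -> A `&` T = set0 -> T !=set0 ->
    (forall z w, T z -> T w -> hmul z w `&` T !=set0) ->
  exists P, [/\ prime_hyperideal P, A `<=` P & P `&` T = set0].
Proof.
move=> Ah AT T0 TM.
(* The order is on the added part [X] of [A `|` X], so that the empty chain,
   whose union is [set0], is bounded by [A] itself. *)
pose E := [set X | hyperideal (A `|` X) /\ (A `|` X) `&` T = set0].
have [F FE Ftot|X [[Xh XT] Xmax]] := @Zorn_bigcup G E.
  split.
    by apply: chain_union_hyperideal => // X /FE[].
  rewrite setIUl AT set0U setI_bigcupl; apply: bigcup0 => X /FE[_].
  by rewrite setIUl AT set0U.
exists (A `|` X); split=> //.
apply: (maximal_avoiding_prime Xh XT T0 TM) => Q Qh [XQ nQX].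
apply/set0P; apply/eqP => QT; apply: (Xmax Q).
  split; first by apply: subset_trans XQ; apply: subsetUr.
  by move=> QX; apply: nQX; apply: subset_trans QX _; apply: subsetUr.
have AQ : A `|` Q = Q.
  by apply/setUidPr; apply: subset_trans XQ; apply: subsetUl.
by split; rewrite AQ.
Qed.

(** * Powers and the radical of a C-hyperideal *)

Lemma in_hprod_rcons a s y w :
  hprod a (rcons s y) w <-> exists2 c, hprod a s c & hmul c y w.
Proof.
rewrite /hprod foldl_rcons; split=> [[c sc [_ -> cyw]]|[c sc cyw]].
  by exists c.
by exists c => //; exists y.
Qed.

Lemma hprod_cat a s b s' y z :
  hprod a s y -> hprod b s' z -> hmul y z `<=` hprod a (s ++ b :: s').
Proof.
move=> sy; elim/last_ind: s' z => [|s' c IH] z.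
  by move=> /= -> w yw; rewrite cats1; apply/in_hprod_rcons; exists y.
move=> /in_hprod_rcons[d s'd dcz] w yzw.
have [e yde ecw] := in_hmulA dcz yzw.
rewrite -rcons_cons -rcons_cat; apply/in_hprod_rcons; exists e => //.
exact: IH s'd _ yde.
Qed.

(** The power [x o ... o x] with [n.+1] factors. *)
Definition hpower x n : set G := hprod x (nseq n x).

Lemma in_hpowerS x n w :
  hpower x n.+1 w <-> exists2 c, hpower x n c & hmul c x w.
Proof.
rewrite /hpower -addn1 nseqD cats1; exact: in_hprod_rcons.
Qed.

Lemma hpower_mul x m n y z :
  hpower x m y -> hpower x n z -> hmul y z `<=` hpower x (m + n.+1).
Proof. by rewrite /hpower nseqD; apply: hprod_cat. Qed.

(** The union [T] of all powers of [x] is multiplicatively closed. If no power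
were included in [A], the C-property would make [T] disjoint from [A], and
prime avoidance would give a prime containing [A] but not [x]. *)
Lemma rad_hpower_sub A x :
  C_hyperideal A -> Defs.rad A x -> exists n, hpower x n `<=` A.
Proof.
move=> [Ah AC] radx; apply: contrapT => /forallNP noPow.
pose T := \bigcup_n hpower x n.
have Tx : T x by exists 0%N.
have [||z w [m _ xz] [n _ xw]|P [Pp AP PT]] := @prime_hyperideal_avoiding A T Ah.
- rewrite -subset0 => y [Ay [n _ xy]]; apply: (noPow n).
  by apply: AC; exists y.
- by exists x.
- have [c zwc] := hmul_neq0 z w; exists c; split=> //.
  by exists (m + n.+1)%N => //; apply: hpower_mul zwc.
- by rewrite -[False]/(set0 x) -PT; split=> //; apply: radx.
Qed.

(** If [x] were outside [P], primality would cancel the last factor: every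
[c] in the shorter power satisfies [hmul c x `<=` P], hence lies in [P]. *)
Lemma prime_hpower P x n : prime_hyperideal P -> hpower x n `<=` P -> P x.
Proof.
move=> [_ _ Pp]; elim: n => [|n IH] xP; first exact: xP.
apply: contrapT => nPx; apply: (nPx); apply: IH => c xc.
have [|//|//] := Pp c x.
by move=> w cxw; apply: xP; apply/in_hpowerS; exists c.
Qed.

Lemma hpower_sub_rad A x n : hpower x n `<=` A -> Defs.rad A x.
Proof.
by move=> xA P [Pp AP]; apply: prime_hpower Pp _; apply: subset_trans xA AP.
Qed.

End HyperidealTheory.

(** * Transport along good homomorphisms *)

Section GoodHomomorphismTheory.
Variables (G1 G2 : comMulHyperringType) (eta : G1 -> G2).
Hypothesis eta_hom : good_hom eta.

Lemma good_hom0 : eta 0 = 0.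
Proof.
have [etaD _ _] := eta_hom.
by apply: (@addrI _ (eta 0)); rewrite -etaD !addr0.
Qed.

Lemma good_homB a b : eta (a - b) = eta a - eta b.
Proof.
have [etaD _ _] := eta_hom.
by apply: (@addIr _ (eta b)); rewrite -etaD !subrK.
Qed.

Lemma good_hom_hmul a b c : hmul a b c -> hmul (eta a) (eta b) (eta c).
Proof. by have [_ <- _] := eta_hom; exists c. Qed.

Lemma good_hom_hmul_sub a b (A : set G2) :
  hmul (eta a) (eta b) `<=` A <-> hmul a b `<=` eta @^-1` A.
Proof. by have [_ <- _] := eta_hom; apply: image_subP. Qed.

Lemma good_hom_hpower x n z : hpower x n z -> hpower (eta x) n (eta z).
Proof.
elim: n z => [z -> //|n IH z /in_hpowerS[c xc cz]].
by apply/in_hpowerS; exists (eta c); [exact: IH|exact: good_hom_hmul].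
Qed.

Lemma preimage_hyperideal A : hyperideal A -> hyperideal (eta @^-1` A).
Proof.
move=> Ah; have [_ AB AM] := Ah; split.
- by exists 0; rewrite /= good_hom0; apply: hyperideal0.
- by move=> x y Ax Ay; rewrite /= good_homB; apply: AB.
- by move=> r x Ax c /good_hom_hmul; apply: AM.
Qed.

Lemma preimage_prime P : prime_hyperideal P -> prime_hyperideal (eta @^-1` P).
Proof.
move=> [Ph PT Pp]; split.
- exact: preimage_hyperideal.
- move=> eT; apply: PT; apply: hyperideal1 => //.
  by have [_ _ <-] := eta_hom; rewrite -[P _]/((eta @^-1` P) hone) eT.
- by move=> x y /good_hom_hmul_sub /Pp.
Qed.

(** The C-property of [A] is what turns membership in the radical into a
statement about powers, which [eta] transports; primes of the source need not
be preimages of primes of the target. *)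
Lemma preimage_rad A :
  C_hyperideal A -> eta @^-1` Defs.rad A `<=` Defs.rad (eta @^-1` A).
Proof.
move=> AC x /(rad_hpower_sub AC)[n xA]; apply: (@hpower_sub_rad _ _ _ n).
by move=> z /good_hom_hpower; apply: xA.
Qed.

Lemma rad_image A : Defs.rad A `<=` eta @^-1` Defs.rad (eta @` A).
Proof.
move=> x radx P [Pp /image_subP AP]; apply: (radx (eta @^-1` P)).
by split=> //; apply: preimage_prime.
Qed.

Lemma image_hyperideal A :
  set_surj setT setT eta -> hyperideal A -> hyperideal (eta @` A).
Proof.
move=> eta_surj [[a Aa] AB AM]; split; first by exists (eta a), a.
- by move=> _ _ [x Ax <-] [y Ay <-]; exists (x - y); [exact: AB|exact: good_homB].
- move=> r' _ [x Ax <-]; have [r _ <-] := eta_surj r' I.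
  by apply/good_hom_hmul_sub => c /(AM r x Ax); exists c.
Qed.

Lemma image_hkerK A :
  hyperideal A -> hker eta `<=` A -> eta @^-1` (eta @` A) `<=` A.
Proof.
move=> Ah kA x [a Aa eax]; rewrite -(subrK a x); apply: hyperidealD => //.
by apply: kA; rewrite /hker /= good_homB eax subrr.
Qed.

Lemma quasi_primary_preimage S A :
    mult_closed S -> C_hyperideal A -> quasi_primary (eta @` S) A ->
  quasi_primary S (eta @^-1` A).
Proof.
move=> S_mcs AC [_ Ah AS [_ [t St <-] At]]; split=> //.
- exact: preimage_hyperideal.
- rewrite -subset0 => x [Ax Sx]; rewrite -[set0 x]/(set0 (eta x)) -AS.
  by split=> //; exists x.
- exists t => // u v /good_hom_hmul_sub /At.
  by move=> [] /good_hom_hmul_sub tw; [left|right];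
    apply: subset_trans tw (preimage_rad AC).
Qed.

Lemma quasi_primary_image S A :
    hker eta `<=` A -> set_surj setT setT eta -> quasi_primary S A ->
  quasi_primary (eta @` S) (eta @` A).
Proof.
move=> kA eta_surj [S_mcs Ah AS [t St At]]; split.
- exact: mult_closed_image.
- exact: image_hyperideal.
- rewrite -subset0 => _ [] /[swap] -[s Ss <-] eAs; rewrite -[set0 _]/(set0 s) -AS.
  by split=> //; apply: image_hkerK.
- exists (eta t) => [|u' v']; first by exists t.
  have [u _ <-] := eta_surj u' I; have [v _ <-] := eta_surj v' I.
  move=> /good_hom_hmul_sub uvA.
  have /At : hmul u v `<=` A by apply: subset_trans uvA _; apply: image_hkerK.
  by move=> [] tw; [left|right]; apply/good_hom_hmul_sub;
    apply: subset_trans tw (@rad_image A).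
Qed.

End GoodHomomorphismTheory.

Theorem theorem2p14 (G1 G2 : comMulHyperringType) (eta : G1 -> G2)
    (A1 : set G1) (A2 : set G2) (S : set G1)
    (eta_hom : good_hom eta)
    (A1_C : C_hyperideal A1) (A2_C : C_hyperideal A2)
    (S_mcs : mult_closed S) (S_0 : ~ (eta @` S) (0 : G2)) :
  (quasi_primary (eta @` S) A2 -> quasi_primary S (eta @^-1` A2)) /\
  (quasi_primary S A1 -> hker eta `<=` A1 -> set_surj setT setT eta ->
   quasi_primary (eta @` S) (eta @` A1)).
Proof.
split; first exact: quasi_primary_preimage.
by move=> A1_qp kA1 eta_surj; apply: quasi_primary_image.
Qed.
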